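(* Let $N$ be a finitely generated nilpotent group and let $G$ be a finitely generated group with $\operatorname{asdim}G<\infty$. Then the restricted wreath product $N\wr G=C_0(N,G)\rtimes N$, with a word metric given by a finite generating set, has polynomial dimension growth, i.e. the function $ad_{N\wr G}(\lambda)$ is bounded from above by a polynomial in $\lambda$.
   Context: Wreath product: $C_0(N,G)=\bigoplus_N G$ is the group (under pointwise multiplication) of functions $f:N\to G$ with finite support $\operatorname{supp}(f)=\{x\in N\mid f(x)\ne 1\}$. The group $N$ acts on $C_0(N,G)$ by $a(f)(x)=f(a^{-1}x)$. The restricted wreath product $N\wr G$ is the semidirect product $C_0(N,G)\rtimes N$, with multiplication $(f,a)(g,b)=(f\,a(g),ab)$. (Note the order of notation: $N$ is the acting group and $G$ the coefficient group.) It is finitely generated. Asymptotic dimension: a family $\mathcal{F}$ of subsets of a metric space $(X,\rho)$ is $r$-disjoint if $\inf\{\rho(x,x')\mid x\in F,x'\in F'\}\ge r$ for all distinct $F,F'\in\mathcal{F}$, and uniformly bounded if $\operatorname{diam}(\mathcal{F})=\sup\{\operatorname{diam}(F)\mid F\in\mathcal{F}\}<\infty$. $\operatorname{asdim}X\le n$ if for every $r<\infty$ there are uniformly bounded $r$-disjoint families $\mathcal{U}^0,\dots,\mathcal{U}^n$ of subsets of $X$ such that $\bigcup_i\mathcal{U}^i$ covers $X$; $\operatorname{asdim}X$ is the least such $n$ ($\infty$ if there is none). Finitely generated groups carry the left-invariant word metric of a finite generating set. Dimension growth: for a cover $\mathcal{U}$ of a metric space $X$, a number $\lambda>0$ is a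 Lebesgue number if every $A\subset X$ of diameter $\le\lambda$ is contained in some $U\in\mathcal{U}$; $L(\mathcal{U})$ is the supremum of all Lebesgue numbers; the multiplicity $m(\mathcal{U})$ is the maximal number of elements of $\mathcal{U}$ with nonempty intersection. Set $$ad_X(\lambda)=\min\{m(\mathcal{U})\mid \mathcal{U}\text{ a uniformly bounded cover of }X,\ L(\mathcal{U})\ge\lambda\}-1.$$ *)

(* Defs.v *)
From HB Require Import structures.
From mathcomp Require Import all_boot all_order all_algebra finmap.
From mathcomp Require Import boolp classical_sets functions cardinality reals
  constructive_ereal ereal topology measure.

Set Implicit Arguments.
Unset Strict Implicit.
Unset Printing Implicit Defensive.

Import Order.TTheory GRing.Theory Num.Theory.

Local Open Scope classical_set_scope.
Local Open Scope ring_scope.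

Section Generation.
Variable G : groupType.
Local Open Scope group_scope.
Implicit Types (A H : set G) (x y g : G).

Definition subgroup H : Prop := group_closed (mem H).

Definition generated A : set G := smallest subgroup A.

Definition finitely_generated : Prop :=
  exists S : {fset G}, generated [set` S] = setT.

Record genset := GenSet {
  gset :> {fset G};
  gsetP : generated [set` gset] = setT }.

Fixpoint lower_central n : set G :=
  if n is n'.+1 then
    generated [set [~ x, y] | x in lower_central n' & y in setT]
  else setT.

Definition nilpotent_group : Prop := exists n, lower_central n = [set 1].

Definition is_word (S : {fset G}) n g : Prop :=
  exists s : seq G, [/\ size s = n,
    all (fun x => (x \in S) || (x^-1 \in S)) s & \prod_(x <- s) x = g].

Lemma is_wordM (S : {fset G}) m n x y :
  is_word S m x -> is_word S n y -> is_word S (m + n) (x * y).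
Proof.
move=> [s [<- Ss <-]] [t [<- St <-]]; exists (s ++ t).
by rewrite size_cat all_cat Ss St big_cat.
Qed.

Lemma is_wordV (S : {fset G}) n x : is_word S n x -> is_word S n x^-1.
Proof.
move=> [s [<- /allP Ss <-]]; exists (rev [seq x^-1 | x <- s]).
rewrite size_rev size_map; split=> //.
  apply/allP => z; rewrite mem_rev => /mapP[y ys ->].
  by rewrite invgK orbC Ss.
rewrite -[LHS]invgK -map_rev big_map prodgV revK.
by rewrite invgK.
Qed.

Variable S : genset.

Lemma is_word_ex g : exists n, `[< is_word S n g >].
Proof.
suff /(_ g I) [n wn] : setT `<=` [set h | exists n, is_word S n h].
  by exists n; apply/asboolP.
rewrite -(gsetP S); apply: smallest_sub.
  split=> [|x y]; rewrite !inE /=.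
    by exists 0%N, [::]; split=> //; rewrite big_nil.
  move=> [m wx] [n wy]; exists (m + n)%N.
  exact/is_wordM/is_wordV.
by move=> x Sx; exists 1%N, [:: x]; rewrite /= Sx big_seq1.
Qed.

Definition word_length g : nat := ex_minn (is_word_ex g).

Lemma word_lengthP g : is_word S (word_length g) g.
Proof. by rewrite /word_length; case: ex_minnP => n /asboolP. Qed.

Lemma word_length_le n g : is_word S n g -> (word_length g <= n)%N.
Proof.
by rewrite /word_length => wg; case: ex_minnP => m _; apply; apply/asboolP.
Qed.

Lemma word_length1 : word_length 1 = 0%N.
Proof.
apply/eqP; rewrite -leqn0; apply: word_length_le.
by exists [::]; split=> //; rewrite big_nil.
Qed.

Lemma word_length_eq0 g : word_length g = 0%N -> g = 1.
Proof.
move=> g0; have := word_lengthP g; rewrite g0.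
by move=> [s [/size0nil -> _]]; rewrite big_nil.
Qed.

Lemma word_lengthV g : word_length g^-1 = word_length g.
Proof.
have le h : (word_length h^-1 <= word_length h)%N.
  exact/word_length_le/is_wordV/word_lengthP.
by apply/eqP; rewrite eqn_leq le -{1}[g]invgK le.
Qed.

Lemma word_lengthM x y : (word_length (x * y) <= word_length x + word_length y)%N.
Proof. by apply: word_length_le; apply: is_wordM; apply: word_lengthP. Qed.

End Generation.

(* G with its left-invariant word metric, as a metric space over R *)
Definition word_space (R : realType) (G : groupType) (S : genset G) : Type := G.

Section WordMetric.
Variables (R : realType) (G : groupType) (S : genset G).
Implicit Types x y z : word_space R S.

HB.instance Definition _ := Choice.copy (word_space R S) G.

Definition word_dist x y : R := (word_length S ((x : G)^-1 * (y : G))%g)%:R.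

Let word_distxx x : word_dist x x = 0.
Proof. by rewrite /word_dist mulVg word_length1. Qed.

Let word_dist_eq0 x y : word_dist x y = 0 -> x = y.
Proof.
move/eqP; rewrite pnatr_eq0 => /eqP/word_length_eq0/mulg1_eq.
by rewrite invgK.
Qed.

Let word_distC x y : word_dist x y = word_dist y x.
Proof. by rewrite /word_dist -word_lengthV invgM invgK. Qed.

Let word_dist_triangle y x z :
  word_dist x z <= word_dist x y + word_dist y z.
Proof.
rewrite /word_dist -natrD ler_nat.
have -> : ((x : G)^-1 * (z : G) = (x : G)^-1 * y * ((y : G)^-1 * z))%g.
  by rewrite mulgA mulgK.
exact: word_lengthM.
Qed.

HB.instance Definition _ := @isMetric.Build R (word_space R S) word_dist
  word_distxx word_dist_eq0 word_distC word_dist_triangle.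

End WordMetric.

Section Dimension.
Variables (R : realType) (X : metricType R).
Implicit Types (A B : set X) (U V : set (set X)) (r lam : R).
Local Open Scope ereal_scope.

Definition diam A : \bar R :=
  ereal_sup (0 |` [set (mdist x y)%:E | x in A & y in A]).

Definition uniformly_bounded U : Prop :=
  ereal_sup [set diam A | A in U] < +oo.

Definition disjoint_family r U : Prop :=
  forall A B, U A -> U B -> A <> B ->
    r%:E <= ereal_inf [set (mdist x y)%:E | x in A & y in B].

Definition asdim_le (n : nat) : Prop :=
  forall r, exists U : 'I_n.+1 -> set (set X),
    (forall i, uniformly_bounded (U i) /\ disjoint_family r (U i)) /\
    \bigcup_i \bigcup_(A in U i) A = setT.

Definition asdim : \bar R := ereal_inf [set n%:R%:E | n in asdim_le].

Definition lebesgue_number U lam : Prop :=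
  (0 < lam)%R /\
  forall A, diam A <= lam%:E -> exists2 B, U B & A `<=` B.

Definition sup_lebesgue U : \bar R :=
  ereal_sup [set lam%:E | lam in lebesgue_number U].

Definition multiplicity U : \bar R :=
  ereal_sup [set counting V | V in
    [set V | V `<=` U /\ \bigcap_(A in V) A !=set0]].

(* The infimum is over a subset of {0, 1, ..., +oo}, hence a minimum. *)
Definition ad lam : \bar R :=
  ereal_inf [set multiplicity U | U in
    [set U | [/\ uniformly_bounded U, \bigcup_(A in U) A = setT
               & lam%:E <= sup_lebesgue U]]] - 1.

Definition polynomial_dimension_growth : Prop :=
  exists p : {poly R}, forall lam, (0 < lam)%R -> ad lam <= (p.[lam])%:E.

End Dimension.
Arguments asdim {R} X.
Arguments polynomial_dimension_growth {R} X.

Definition C0 (N G : groupType) : Type := {fsfun N -> G with 1%g}.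

Section FiniteSupport.
Variables N G : groupType.
Local Open Scope group_scope.
Local Open Scope fset_scope.
Implicit Types (f g h : C0 N G) (a b x : N).

HB.instance Definition _ := Choice.copy (C0 N G) {fsfun N -> G with 1%g}.

Definition c0_fun f : N -> G := fun_of_fsfun f.
Coercion c0_fun : C0 >-> Funclass.

Definition c0_one : C0 N G := [fsfun with 1].
Definition c0_mul f g : C0 N G :=
  [fsfun x in finsupp f `|` finsupp g => f x * g x | 1].
Definition c0_inv f : C0 N G := [fsfun x in finsupp f => (f x)^-1 | 1].

Definition c0_act a f : C0 N G :=
  [fsfun x in [fset a * y | y in finsupp f] => f (a^-1 * x) | 1].

Let c0P f g : f =1 g -> f = g. Proof. by move/fsfunP. Qed.

Lemma c0_oneE x : c0_one x = 1. Proof. exact: fsfun0E. Qed.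

Lemma c0_mulE f g x : c0_mul f g x = f x * g x.
Proof.
rewrite /c0_mul /c0_fun fsfun_fun in_fsetU; case: finsuppP => [xf|//] /=.
by case: finsuppP => // _; rewrite mulg1.
Qed.

Lemma c0_invE f x : c0_inv f x = (f x)^-1.
Proof.
by rewrite /c0_inv /c0_fun fsfun_fun; case: finsuppP => //= *; rewrite invg1.
Qed.

Lemma c0_actE a f x : c0_act a f x = f (a^-1 * x).
Proof.
rewrite /c0_act /c0_fun fsfun_fun; case: ifPn => // /negP nx.
case: finsuppP => // xf; case: nx; apply/imfsetP => /=.
by exists (a^-1 * x) => //; rewrite mulVKg.
Qed.

Let c0_mulA : associative c0_mul.
Proof. by move=> f g h; apply: c0P => x; rewrite !c0_mulE mulgA. Qed.
Let c0_mul1g : left_id c0_one c0_mul.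
Proof. by move=> f; apply: c0P => x; rewrite c0_mulE c0_oneE mul1g. Qed.
Let c0_mulg1 : right_id c0_one c0_mul.
Proof. by move=> f; apply: c0P => x; rewrite c0_mulE c0_oneE mulg1. Qed.
Let c0_mulVg : left_inverse c0_one c0_inv c0_mul.
Proof. by move=> f; apply: c0P => x; rewrite c0_mulE c0_invE c0_oneE mulVg. Qed.
Let c0_mulgV : right_inverse c0_one c0_inv c0_mul.
Proof. by move=> f; apply: c0P => x; rewrite c0_mulE c0_invE c0_oneE mulgV. Qed.

HB.instance Definition _ := isGroup.Build (C0 N G)
  c0_mulA c0_mul1g c0_mulg1 c0_mulVg c0_mulgV.

Lemma c0_act1 f : c0_act 1 f = f.
Proof. by apply: c0P => x; rewrite c0_actE invg1 mul1g. Qed.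

Lemma c0_actA a b f : c0_act a (c0_act b f) = c0_act (a * b) f.
Proof. by apply: c0P => x; rewrite !c0_actE invgM mulgA. Qed.

Lemma c0_actM a f g : c0_act a (f * g) = c0_act a f * c0_act a g.
Proof. by apply: c0P => x; rewrite c0_mulE !c0_actE c0_mulE. Qed.

Lemma c0_act_one a : c0_act a 1 = 1.
Proof. by apply: c0P => x; rewrite c0_actE !c0_oneE. Qed.

End FiniteSupport.

(* Restricted wreath product: N acts, G is the coefficient group. *)
Record wreath (N G : groupType) := Wreath { lamps : C0 N G; cursor : N }.

Section Wreath.
Variables N G : groupType.
Local Open Scope group_scope.
Implicit Types u v w : wreath N G.

Definition pair_of_wreath u : C0 N G * N := (lamps u, cursor u).
Definition wreath_of_pair (q : C0 N G * N) := Wreath q.1 q.2.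
Lemma pair_of_wreathK : cancel pair_of_wreath wreath_of_pair.
Proof. by case. Qed.

HB.instance Definition _ := Choice.copy (wreath N G) (can_type pair_of_wreathK).

Definition wreath_one : wreath N G := Wreath 1 1.
Definition wreath_mul u v : wreath N G :=
  Wreath (lamps u * c0_act (cursor u) (lamps v)) (cursor u * cursor v).
Definition wreath_inv u : wreath N G :=
  Wreath (c0_act (cursor u)^-1 (lamps u)^-1) (cursor u)^-1.

Let wreath_mulA : associative wreath_mul.
Proof.
by move=> u v w; rewrite /wreath_mul /= c0_actM c0_actA !mulgA.
Qed.
Let wreath_mul1g : left_id wreath_one wreath_mul.
Proof. by case=> f a; rewrite /wreath_mul /= c0_act1 !mul1g. Qed.
Let wreath_mulg1 : right_id wreath_one wreath_mul.
Proof. by case=> f a; rewrite /wreath_mul /= c0_act_one !mulg1. Qed.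
Let wreath_mulVg : left_inverse wreath_one wreath_inv wreath_mul.
Proof.
by case=> f a; rewrite /wreath_mul /= -c0_actM !mulVg c0_act_one.
Qed.
Let wreath_mulgV : right_inverse wreath_one wreath_inv wreath_mul.
Proof.
by case=> f a; rewrite /wreath_mul /= c0_actA !mulgV c0_act1 mulgV.
Qed.

HB.instance Definition _ := isGroup.Build (wreath N G)
  wreath_mulA wreath_mul1g wreath_mulg1 wreath_mulVg wreath_mulgV.

End Wreath.

(* Main.v *)
(** An element of word length l moves the cursor by at most C l, and changes
    lamps only within distance C l of the cursor, each by at most C l in G.
    Hence sets of diameter at most l see a product of |B| copies of G, where B
    is the ball of radius C l in N, and |B| is polynomial in l because N is
    nilpotent.  If asdim G <= n, Kolmogorov's trick provides n |B| + 1 bounded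
    disjoint families in G such that each point is missed by at most n of them;
    every point of G^B is then covered, in all its coordinates simultaneously,
    by one family.  Thickening the resulting products gives, over each ball of
    N, a cover of multiplicity at most n |B| + 1, and at most |B| such balls
    contain a given cursor.  The multiplicity is thus at most
    |B| (n |B| + 1).

    For the growth of N, a letter g is collected on the left of a word:
    s = g^e times a product of conjugates of the other letters by powers of g.
    By nilpotency x^(g^e) is a word of length polynomial in e in the letters
    x, [x, g], [[x, g], g], ..., of which all but the first lie deeper in the
    lower central series. *)
Require Import Defs.
From HB Require Import structures.
From mathcomp Require Import all_boot all_order all_algebra finmap.
From mathcomp Require Import boolp classical_sets functions cardinality reals
  constructive_ereal ereal topology measure.
From mathcomp Require Import zify.

Set Implicit Arguments.
Unset Strict Implicit.
Unset Printing Implicit Defensive.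

Import Order.TTheory GRing.Theory Num.Theory.

(** * Polynomial growth of nilpotent groups by collection of letters *)

Section PolynomialGrowth.
Variable N : groupType.
Implicit Types (A B : seq N) (g x y : N) (m n d e : nat).
Local Open Scope classical_set_scope.
Local Open Scope group_scope.

(** Inverses are not allowed unless listed in [A], so collecting a letter [g] produces only
    nonnegative powers of [g]. *)
Definition short_word A n x : Prop := exists s : seq N,
  [/\ (size s <= n)%N, {subset s <= A} & \prod_(y <- s) y = x].

Lemma leq_expl m n e : (m <= n)%N -> (m ^ e <= n ^ e)%N.
Proof. by case: e => // e mn; rewrite leq_exp2r. Qed.

Lemma short_word1 A n : short_word A n 1.
Proof. by exists [::]; rewrite big_nil. Qed.

Lemma short_word_letter A n x : x \in A -> (0 < n)%N -> short_word A n x.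
Proof.
move=> Ax n0; exists [:: x]; rewrite big_seq1; split=> // y.
by rewrite inE => /eqP->.
Qed.

Lemma short_wordM A m n x y :
  short_word A m x -> short_word A n y -> short_word A (m + n) (x * y).
Proof.
move=> [s [sm sA <-]] [t [tn tA <-]]; exists (s ++ t).
rewrite size_cat leq_add// big_cat; split=> // z.
by rewrite mem_cat => /orP[/sA|/tA].
Qed.

Lemma short_wordS A B m n x :
  {subset A <= B} -> (m <= n)%N -> short_word A m x -> short_word B n x.
Proof.
move=> AB mn [s [sm sA <-]]; exists s; split=> //; first exact: leq_trans mn.
by move=> y /sA/AB.
Qed.

(** Since [x ^ g = x * [~ x, g]], conjugating by one more [g] splits [x] into itself and [[~ x, g]],
    a Pascal recursion. The bound follows from (e+1)^(d+1) + (e+1)^d = (e+2)(e+1)^d. *)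
Lemma conjX_short_word g x d e : iter d (fun y => [~ y, g]) x = 1 ->
  short_word (traject (fun y => [~ y, g]) x d) (e.+1 ^ d) (x ^ (g ^+ e)).
Proof.
elim: e x d => [|e IH] x [|d] /= H.
- by rewrite H conj1g; apply: short_word1.
- by rewrite expg0 conjg1; apply: short_word_letter; rewrite ?mem_head ?exp1n.
- by rewrite H conj1g; apply: short_word1.
have xg : x ^ g = x * [~ x, g] by rewrite commgEl mulVKg.
rewrite expgS conjgM xg conjMg.
have H' : iter d (fun y => [~ y, g]) [~ x, g] = 1 by rewrite -iterSr.
have yx : short_word (traject (fun y => [~ y, g]) x d.+1) (e.+1 ^ d)
    ([~ x, g] ^ (g ^+ e)).
  apply: short_wordS (IH _ d H') => // y /= yd.
  by rewrite inE yd orbT.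
have := short_wordM (IH x d.+1 H) yx; apply: short_wordS => //.
by rewrite expnS -mulSnr [leqRHS]expnS leq_mul2l leq_expl.
Qed.

(** A letter [x] put in front of [g ^+ e] crosses it as [x ^ (g ^+ e)]. As [e] never exceeds the
    fixed [n], each crossing costs at most (n+1)^d letters. *)
Lemma collect_letter g A d n s :
    {in A, forall x, iter d (fun y => [~ y, g]) x = 1} ->
    {subset s <= g :: A} -> (size s <= n)%N ->
  exists e y, [/\ (e <= size s)%N, \prod_(x <- s) x = g ^+ e * y &
    short_word (flatten [seq traject (fun y => [~ y, g]) x d | x <- A])
      (size s * n.+1 ^ d) y].
Proof.
move=> Ad; elim: s => [|x s IH] sA sn.
  by exists 0%N, 1; rewrite big_nil mulg1; split=> //; apply: short_word1.
have [||e [y [es sE yA]]] := IH; last 1 first.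
- have := sA x (mem_head _ _); rewrite inE big_cons sE => /orP[/eqP->|Ax].
  + exists e.+1, y; split=> //; first by rewrite expgS mulgA.
    by apply: short_wordS yA => //=; rewrite leq_mul2r leqnSn orbT.
  + exists e, (x ^ (g ^+ e) * y); split; first exact: leqW.
      by rewrite [LHS]mulgA (conjgC x) -(mulgA (g ^+ e)).
    rewrite [size _]/= mulSn; apply: short_wordM => //.
    apply: short_wordS (conjX_short_word e (Ad _ Ax)).
      by move=> z zx; apply/flatten_mapP; exists x.
    by apply: leq_expl; rewrite ltnS (leq_trans es)// ltnW.
- by move=> z zs; apply: sA; rewrite inE zs orbT.
- exact: ltnW.
Qed.
Definition poly_growth A : Prop := exists C d, forall n, exists B,
  (size B <= C * n.+1 ^ d)%N /\ forall x, short_word A n x -> x \in B.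

Lemma poly_growth_sub A B : {subset A <= B} -> poly_growth B -> poly_growth A.
Proof.
move=> AB [C [d H]]; exists C, d => n; have [L [sL HL]] := H n.
by exists L; split=> // x /(short_wordS AB (leqnn n))/HL.
Qed.

Lemma poly_growth_cons g A d :
    {in A, forall x, iter d (fun y => [~ y, g]) x = 1} ->
    poly_growth (flatten [seq traject (fun y => [~ y, g]) x d | x <- A]) ->
  poly_growth (g :: A).
Proof.
move=> Ad [C [k H]]; exists C, (d.+1 * k).+1 => n.
have [L [sL HL]] := H (n * n.+1 ^ d)%N.
exists [seq g ^+ e * y | e <- iota 0 n.+1, y <- L]; split.
  rewrite size_allpairs size_iota expnS mulnCA leq_mul2l /=.
  apply: leq_trans sL _; rewrite leq_mul2l expnM leq_expl ?orbT// expnS mulSn.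
  by rewrite -[leqLHS]add1n leq_add2r expn_gt0.
move=> x [s [sn sA <-]].
have [e [y [es -> yA]]] := collect_letter Ad sA sn.
apply/allpairsP; exists (e, y); split=> //.
  by rewrite mem_iota add0n ltnS (leq_trans es).
by apply/HL/(short_wordS _ _ yA) => //; rewrite leq_mul2r sn orbT.
Qed.

Lemma lower_centralR i x y :
  lower_central i x -> lower_central i.+1 [~ x, y].
Proof.
move=> xi; apply: (@sub_gen_smallest _ (@subgroup N)).
by exists x => //; exists y.
Qed.

Lemma generated_subgroup (A : set N) : subgroup (generated A).
Proof.
split=> [|x y]; rewrite !inE.
  by move=> H [[+ _] _]; rewrite inE.
move=> xA yA H [H1 H2]; have [_ HB] := H1.
by have := HB x y; rewrite !inE; apply; [apply: xA|apply: yA].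
Qed.

Lemma lower_central_sub i : @lower_central N i.+1 `<=` @lower_central N i.
Proof.
elim: i => [//|i IH]; apply: smallest_sub; first exact: generated_subgroup.
by move=> _ [x /IH xi [y _ <-]]; apply: lower_centralR.
Qed.

Lemma lower_central_iter g m i x :
  lower_central i x -> lower_central (i + m) (iter m (fun y => [~ y, g]) x).
Proof.
move=> xi; elim: m => [|m IH]; first by rewrite addn0.
by rewrite addnS; exact: (lower_centralR g IH).
Qed.

Lemma lower_central_iter_sub g m i x :
  lower_central i x -> lower_central i (iter m (fun y => [~ y, g]) x).
Proof.
move=> xi; elim: m => [//|m IH].
by apply: lower_central_sub; exact: (lower_centralR g IH).
Qed.

(** Outer induction on the depth [m] left below layer [i], inner induction on the letters [A] of
    that layer. Collecting [g] from [A] creates new letters only in layer i+1, which join [B]; once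
    [A] is empty, [B] takes its place one layer deeper. *)
Lemma poly_growth_central m i A B :
    @lower_central N (i + m) `<=` [set 1] ->
    {in A, forall x, lower_central i x} ->
    {in B, forall x, lower_central i.+1 x} ->
  poly_growth (A ++ B).
Proof.
elim: m i A B => [|m IHm] i A B im.
  rewrite addn0 in im => Ai Bi; exists 1%N, 0%N => n; exists [:: 1]; split=> //.
  move=> x [s [_ sA <-]]; rewrite big1_seq ?mem_head// => y /= /sA.
  by rewrite mem_cat => /orP[/Ai/im|/Bi/lower_central_sub/im].
elim: A B => [|g A IHA] B Ai Bi.
  by rewrite -[_ ++ _]cats0; apply: (IHm i.+1) => //; rewrite addSnnS.
pose f := fun y => [~ y, g].
have Aj x : x \in A -> lower_central i x.
  by move=> xA; apply: Ai; rewrite inE xA orbT.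
apply: (@poly_growth_cons g (A ++ B) m.+1) => [x|].
  rewrite mem_cat => xAB; apply: im; apply: lower_central_iter.
  by case/orP: xAB => [/Aj|/Bi/lower_central_sub].
(* The trajectory of a letter of [A] without its start, which stays in [A], and the full
   trajectories of the letters of [B]. *)
pose B' := flatten [seq traject f (f x) m | x <- A] ++
           flatten [seq traject f x m.+1 | x <- B].
apply: (@poly_growth_sub _ (A ++ B')) => [y|]; last first.
  apply: IHA => // y; rewrite mem_cat => /orP[]/flatten_mapP[x xX]/trajectP[k _ ->].
    apply: lower_central_iter_sub. exact: (lower_centralR g (Aj _ xX)).
  by apply: lower_central_iter_sub; apply: Bi.
move=> /flatten_mapP[x]; rewrite !mem_cat => /orP[xA|xB] yx.
  move: yx; rewrite inE => /orP[/eqP->|yx]; first by rewrite xA.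
  by apply/orP; right; apply/orP; left; apply/flatten_mapP; exists x.
by apply/orP; right; apply/orP; right; apply/flatten_mapP; exists x.
Qed.

Lemma nilpotent_poly_growth A : nilpotent_group N -> poly_growth A.
Proof.
move=> [c c1]; rewrite -[A]cats0; apply: (@poly_growth_central c 0%N) => //.
by rewrite add0n c1.
Qed.

End PolynomialGrowth.

(** * Balls in the word metric *)

Section Balls.
Variable G : groupType.
Variable S : genset G.
Local Open Scope group_scope.
Implicit Types x y z : G.

Lemma word_length_short_word n x : (word_length S x <= n)%N ->
  short_word (S ++ [seq y^-1 | y <- S]) n x.
Proof.
move=> xn; have [s [sn /allP sS sx]] := word_lengthP S x.
exists s; split=> [||//]; first by rewrite sn.
move=> y /sS /orP[yS|yS]; rewrite mem_cat ?yS//.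
by rewrite -[y]invgK map_f ?orbT.
Qed.

Lemma short_words_finite (A : seq G) n :
  exists B : seq G, forall x, short_word A n x -> x \in B.
Proof.
elim: n => [|n [B HB]].
  exists [:: 1] => x [s [/[!leqn0]/nilP-> _ <-]].
  by rewrite big_nil mem_head.
exists (1 :: [seq a * y | a <- A, y <- B]) => x [[|a s] [sn sA <-]].
  by rewrite big_nil mem_head.
rewrite big_cons inE; apply/orP; right; apply/allpairsP.
exists (a, \prod_(y <- s) y); split=> //=; first exact/sA/mem_head.
by apply: HB; exists s; split=> // y ys; apply: sA; rewrite inE ys orbT.
Qed.

Lemma ball_finite n :
  exists B : seq G, forall x, (word_length S x <= n)%N -> x \in B.
Proof.
have [B HB] := short_words_finite (S ++ [seq y^-1 | y <- S]) n.
by exists B => x /word_length_short_word/HB.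
Qed.

Lemma nilpotent_ball_growth : nilpotent_group G -> exists C d, forall n,
  exists B : seq G, (size B <= C * n.+1 ^ d)%N /\
    forall x, (x \in B) = (word_length S x <= n)%N.
Proof.
move=> /(nilpotent_poly_growth (S ++ [seq y^-1 | y <- S])) [C [d H]].
exists C, d => n; have [B [sB HB]] := H n.
exists [seq x <- B | (word_length S x <= n)%N]; split=> [|x].
  by rewrite size_filter (leq_trans (count_size _ _)).
rewrite mem_filter andb_idr// => xn.
exact/HB/word_length_short_word.
Qed.

(** * Colourings at a given scale and Kolmogorov's trick *)

Definition gdist x y : nat := word_length S (x^-1 * y).

Lemma gdistxx x : gdist x x = 0%N.
Proof. by rewrite /gdist mulVg word_length1. Qed.

Lemma gdistC x y : gdist x y = gdist y x.
Proof. by rewrite /gdist -word_lengthV invgM invgK. Qed.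

Lemma gdist_triangle y x z : (gdist x z <= gdist x y + gdist y z)%N.
Proof.
rewrite /gdist (_ : x^-1 * z = x^-1 * y * (y^-1 * z)) ?word_lengthM//.
by rewrite mulgA mulgK.
Qed.

(* A uniformly bounded r-disjoint family, encoded by the partial equivalence
   relation "x and y lie in a common member"; [E x x] says that x is covered. *)
Definition colour_class (r D : nat) (E : G -> G -> Prop) : Prop :=
  [/\ forall x y, E x y -> E y x,
      forall y x z, E x y -> E y z -> E x z,
      forall x y, E x y -> (gdist x y <= D)%N &
      forall x y, E x x -> E y y -> (gdist x y <= r)%N -> E x y].

Definition colouring K r D (E : nat -> G -> G -> Prop) : Prop :=
  forall i, (i < K)%N -> colour_class r D (E i).

Definition missed K (E : nat -> G -> G -> Prop) x : nat :=
  \sum_(i < K) ~~ `[< E i x x >].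

Definition thicken r (E : G -> G -> Prop) x y : Prop :=
  exists x' y', [/\ E x' y', (gdist x x' <= r)%N & (gdist y y' <= r)%N].

(** Two thickened points at distance at most [r] come from original points at distance at most 3r,
    hence from one member. *)
Lemma colour_class_thicken r s D E : (3 * r <= s)%N -> colour_class s D E ->
  colour_class r (D + 2 * r) (thicken r E).
Proof.
move=> rs [Es Et Eb Ed].
have El x y : E x y -> E x x by move=> xy; apply: (Et y) => //; apply: Es.
have Er x y : E x y -> E y y by move=> /Es; apply: El.
split.
- by move=> x y [x' [y' [xy xr yr]]]; exists y', x'; split=> //; apply: Es.
- move=> y x z [x' [y' [xy xr yr]]] [y2 [z' [yz yr2 zr]]].
  exists x', z'; split=> //; apply: (Et y') => //; apply: (Et y2) => //.
  apply: Ed; [exact: Er xy|exact: El yz|].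
  have := gdist_triangle y y' y2; rewrite (gdistC y' y); lia.
- move=> x y [x' [y' [/Eb xy xr yr]]].
  have := gdist_triangle x' x y; have := gdist_triangle y' x' y.
  rewrite (gdistC y' y); lia.
- move=> x y [x' [x2 [xx xr _]]] [y' [y2 [yy yr _]]] xy.
  exists x', y'; split=> //; apply: Ed; [exact: El xx|exact: El yy|].
  have := gdist_triangle x x' y'; have := gdist_triangle y x y'.
  rewrite (gdistC x' x); lia.
Qed.

(* Kolmogorov's trick: points which no thickened family gains over the
   original families are covered by the "common refinement" of the latter. *)
Lemma colouring_extend n K s r D E : (n < K)%N -> (3 * r <= s)%N ->
    colouring K s D E -> (forall x, (missed K E x <= n)%N) ->
  exists D' E', colouring K.+1 r D' E' /\ forall x, (missed K.+1 E' x <= n)%N.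
Proof.
move=> nK rs EK En.
have Es i x y : (i < K)%N -> E i x y -> E i y x by move=> /EK[+ _ _ _]; apply.
have Et i y x z : (i < K)%N -> E i x y -> E i y z -> E i x z.
  by move=> /EK[_ + _ _]; apply.
have Er i x y : (i < K)%N -> E i x y -> E i y y.
  by move=> iK xy; apply: (Et i x) => //; apply: Es.
have thickE i x : E i x x -> thicken r (E i) x x.
  by exists x, x; rewrite gdistxx.
pose P x := forall i, (i < K)%N -> thicken r (E i) x x -> E i x x.
(* Points are identified when the same colours cover both and put them into common members. *)
pose F x y := [/\ P x, P y &
  forall i, (i < K)%N -> E i x x \/ E i y y -> E i x y].
pose E' i := if (i < K)%N then thicken r (E i) else F.
exists (D + 2 * r)%N, E'; split=> [i|x].
  rewrite ltnS leq_eqVlt => /orP[/eqP->|iK]; last first.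
    by rewrite /E' iK; apply: colour_class_thicken rs _; apply: EK.
  rewrite /E' ltnn; split.
  - move=> x y [Px Py xy]; split=> // j jK /or_comm /(xy j jK).
    exact: Es.
  - move=> y x z [Px Py xy] [_ Pz yz]; split=> // j jK [xx|zz].
      have xyj := xy j jK (or_introl xx).
      by apply: (Et j y) => //; apply: yz => //; left; apply: Er xyj.
    have yzj := yz j jK (or_intror zz).
    apply: (Et j y) => //; apply: xy => //; right.
    by apply: (Er j z) => //; apply: Es.
  - move=> x y [_ _ xy].
    (* At most n < K colours miss [x], so some colour covers it and bounds the class of [x] under
       [F] by [D]. *)
    have [j xx] : exists j : 'I_K, E j x x.
      apply/not_existsP => H; have := En x; rewrite leqNgt => /negP; apply.
      apply: leq_trans nK _; rewrite /missed (eq_bigr (fun=> 1%N)) => [|j _].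
        by rewrite sum1_card card_ord.
      by apply/eqP; rewrite eqb1; apply/asboolPn/H.
    have [_ _ Eb _] := EK j (ltn_ord j).
    by apply: leq_trans (leq_addr _ _); apply/Eb/xy => //; left.
  (* A colour covering one of two [r]-close points covers the other after thickening, hence by [P]
     already before. *)
  - move=> x y [Px _ _] [Py _ _] xy; split=> // j jK H.
    have [_ _ _ Ed] := EK j jK.
    have sr : (gdist x y <= s)%N by lia.
    case: H => H.
      apply: Ed => //; apply: Py => //; exists x, x; split=> //;
      by rewrite gdistC.
    by apply: Ed => //; apply: Px => //; exists y, y.
rewrite /missed big_ord_recr /= {2}/E' ltnn.
have -> : (\sum_(i < K) ~~ `[< E' i x x >] =
    \sum_(i < K) ~~ `[< thicken r (E i) x x >])%N.
  by apply: eq_bigr => i _; rewrite /E' ltn_ord.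
have le_miss i : (~~ `[< thicken r (E i) x x >] <= ~~ `[< E i x x >])%N.
  by case: asboolP => // nt; case: asboolP => // /thickE/nt.
(* Either the new colour covers [x], or some thickened colour gains [x], which pays for the miss of
   the new one. *)
have [Px|/existsNP[i /not_implyP[iK /not_implyP[ti ni]]]] := pselect (P x).
  have -> : `[< F x x >].
    by apply/asboolP; split=> // i _ [].
  by rewrite addn0 (leq_trans _ (En x))//; apply: leq_sum => i _; apply: le_miss.
apply: leq_trans (En x); rewrite /missed [X in (X + _)%N](bigD1 (Ordinal iK)) //=.
rewrite [leqRHS](bigD1 (Ordinal iK)) //=.
rewrite (asboolT ti) (asboolF ni) /= add0n addnC leq_add ?leq_b1//.
by apply: leq_sum => j _; apply: le_miss.
Qed.

(** Each added colour costs a factor 3 in the scale, so the scale is quantified inside the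
    induction. *)
Lemma colouring_all n K :
    (forall r, exists D E, colouring n.+1 r D E /\
      forall x, (missed n.+1 E x <= n)%N) ->
    (n < K)%N ->
  forall r, exists D E, colouring K r D E /\ forall x, (missed K E x <= n)%N.
Proof.
move=> H; elim: K => // K IH; rewrite ltnS leq_eqVlt => /orP[/eqP<-//|nK] r.
have [D [E [EK En]]] := IH nK (3 * r)%N.
exact: colouring_extend EK En.
Qed.

(** Pigeonhole: the points indexed by [B] together miss at most [n * size B] colours. *)
Lemma common_colour n K E (I : eqType) (B : seq I) (f : I -> G) :
    (forall x, (missed K E x <= n)%N) -> (n * size B < K)%N ->
  exists i : 'I_K, {in B, forall j, E i (f j) (f j)}.
Proof.
move=> En BK; apply/not_existsP => H.
have : (K <= \sum_(i < K) \sum_(j <- B) ~~ `[< E i (f j) (f j) >])%N.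
  rewrite -[leqLHS]card_ord -sum1_card; apply: leq_sum => i _.
  have /existsNP[j /not_implyP[jB /asboolPn Ej]] := H i.
  by rewrite (big_rem j) //= Ej.
rewrite exchange_big leqNgt => /negP; apply; apply: leq_ltn_trans BK.
apply: leq_trans (leq_sum _ (fun j _ => En (f j))) _.
by rewrite big_const_seq count_predT iter_addn_0.
Qed.

End Balls.

(** * Diameters and asymptotic dimension in terms of integer distances *)

Section WordSpace.
Variables (R : realType) (G : groupType) (S : genset G).
Local Open Scope classical_set_scope.
Local Open Scope ring_scope.
Local Open Scope ereal_scope.
Implicit Types x y : word_space R S.

Lemma mdist_gdist x y : mdist x y = (gdist S x y)%:R.
Proof. by []. Qed.

Lemma diam_leP (A : set (word_space R S)) (l : R) : (0 <= l)%R ->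
  diam A <= l%:E <-> forall x y, A x -> A y -> ((gdist S x y)%:R <= l)%R.
Proof.
move=> l0; split=> [Al x y Ax Ay|H].
  rewrite -lee_fin -mdist_gdist; apply: le_trans Al.
  by apply: ereal_sup_ubound; right; exists x => //; exists y.
apply: ge_ereal_sup => _ [->|[x Ax [y Ay <-]]]; first by rewrite lee_fin.
by rewrite lee_fin mdist_gdist; apply: H.
Qed.

Lemma uniformly_boundedP (U : set (set (word_space R S))) :
  uniformly_bounded U <-> exists D, forall A x y,
    U A -> A x -> A y -> (gdist S x y <= D)%N.
Proof.
split=> [|[D H]]; last first.
  apply: (@le_lt_trans _ _ D%:R%:E); last exact: ltry.
  apply: ge_ereal_sup => _ [A UA <-]; apply/diam_leP => // x y Ax Ay.
  by rewrite ler_nat; apply: H Ax Ay.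
rewrite /uniformly_bounded; set M := ereal_sup _ => Moo.
have diamM A : U A -> diam A <= M by move=> UA; apply: ereal_sup_ubound; exists A.
exists (Num.bound (fine M)) => A x y UA Ax Ay.
have M0 : 0 <= M.
  apply: le_trans (diamM A UA); apply: ereal_sup_ubound; left; reflexivity.
have Mfin : M \is a fin_num by rewrite ge0_fin_numE.
rewrite -(ler_nat R); apply: le_trans (ltW (archi_boundP _)); last exact: fine_ge0.
have /diam_leP : diam A <= (fine M)%:E by rewrite fineK//; apply: diamM.
by apply => //; exact: fine_ge0.
Qed.

Lemma asdim_colouring : asdim (word_space R S) < +oo ->
  exists n, forall r, exists D E, colouring S n.+1 r D E /\
    forall x : G, (missed n.+1 E x <= n)%N.
Proof.
move=> /ereal_inf_lt[_ [n Hn <-] _]; exists n => r.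
(* Scale r+1, because disjointness is a non-strict lower bound while points at distance exactly [r]
   must share a member. *)
have [U [Uok Ucov]] := Hn r.+1%:R.
have /choice[D HD] i : exists D, forall A x y,
    U i A -> A x -> A y -> (gdist S x y <= D)%N.
  by apply/uniformly_boundedP; case: (Uok i).
pose E i (x y : G) := exists (j : 'I_n.+1) A, [/\ j = i :> nat, U j A, A x & A y].
have Udisj j A B (x y : G) : U j A -> U j B -> A x -> B y ->
    (gdist S x y <= r)%N -> A = B.
  move=> UA UB Ax By xy; apply: contrapT => AB.
  have [_ /(_ A B UA UB AB)] := Uok j; apply/negP; rewrite -ltNge.
  apply: (@le_lt_trans _ _ (mdist (x : word_space R S) y)%:E).
    by apply: ereal_inf_lbound; exists x => //; exists y.
  by rewrite lte_fin mdist_gdist ltr_nat.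
exists (\max_i D i), E; split=> [i iK|x].
  split.
  - by move=> x y [j [A [ji UA Ax Ay]]]; exists j, A.
  - move=> y x z [j [A [ji UA Ax Ay]]] [k [B [ki UB By Bz]]].
    have jk : k = j by apply: val_inj; rewrite /= ji ki.
    rewrite {k}jk in UB ki; exists j, A; split=> //.
    by rewrite (Udisj j A B y y UA UB) // gdistxx.
  - move=> x y [j [A [_ UA Ax Ay]]].
    exact: leq_trans (HD j A x y UA Ax Ay) (leq_bigmax j).
  - move=> x y [j [A [ji UA Ax _]]] [k [B [ki UB By _]]] xy.
    have jk : k = j by apply: val_inj; rewrite /= ji ki.
    rewrite {k}jk in UB ki; exists j, A; split=> //.
    by rewrite (Udisj j A B x y UA UB).
have : (\bigcup_i \bigcup_(A in U i) A) x by rewrite Ucov.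
move=> [j _ [A UA Ax]]; rewrite /missed (bigD1 j)//= asboolT ?add0n; last first.
  by exists j, A.
apply: (@leq_trans (\sum_(i < n.+1 | i != j) 1)%N).
  by apply: leq_sum => i _; apply: leq_b1.
by rewrite sum1_card cardC1 card_ord.
Qed.

End WordSpace.

(** * Word length in the wreath product compared with boxes *)

Section WreathMetric.
Variables (N G : groupType) (SN : genset N) (SG : genset G).
Variable T : genset (wreath N G).
Local Open Scope group_scope.
Implicit Types (u v w : wreath N G) (y : N) (m n : nat).

Lemma lampsM u v y :
  lamps (u * v) y = lamps u y * lamps v ((cursor u)^-1 * y).
Proof. by rewrite c0_mulE c0_actE. Qed.

Lemma lamps_div u v y :
  lamps (u^-1 * v) y = (lamps u (cursor u * y))^-1 * lamps v (cursor u * y).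
Proof. by rewrite lampsM /= c0_actE invgK c0_invE. Qed.

Lemma lamps1 y : lamps (1 : wreath N G) y = 1.
Proof. exact: c0_oneE. Qed.

Definition box m u : Prop :=
  [/\ (word_length SN (cursor u) <= m)%N,
      forall y, lamps u y <> 1 -> (word_length SN y <= m)%N &
      forall y, (word_length SG (lamps u y) <= m)%N].

Lemma box1 m : box m 1.
Proof.
by split=> [|y|y]; rewrite ?lamps1 ?word_length1.
Qed.

Lemma boxM m n u v : box m u -> box n v -> box (m + n) (u * v).
Proof.
move=> [um us ul] [vn vs vl]; split=> [|y|y].
- by rewrite (leq_trans (word_lengthM _ _ _))// leq_add.
- have [u1|/us um' _] := pselect (lamps u y = 1); last exact: leq_trans (leq_addr _ _).
  rewrite lampsM u1 mul1g => /vs yn.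
  by rewrite -(mulVKg (cursor u) y) (leq_trans (word_lengthM _ _ _))// leq_add.
- by rewrite lampsM (leq_trans (word_lengthM _ _ _))// leq_add.
Qed.

Lemma box_le m n u : (m <= n)%N -> box m u -> box n u.
Proof.
by move=> mn [um us ul]; split=> [|y /us|y]; move=> *; apply: leq_trans mn.
Qed.

Lemma box_ex u : exists m, box m u.
Proof.
pose F y := (word_length SN y + word_length SG (lamps u y))%N.
exists (word_length SN (cursor u) + \sum_(y <- finsupp (lamps u)) F y)%N.
have FS y : lamps u y <> 1 -> (F y <= \sum_(y <- finsupp (lamps u)) F y)%N.
  move=> /eqP uy; have yS : y \in finsupp (lamps u) by rewrite mem_finsupp.
  by rewrite (big_rem y)//= leq_addr.
split=> [|y /FS|y]; first exact: leq_addr.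
  by rewrite /F; lia.
have [->|/FS] := pselect (lamps u y = 1); first by rewrite word_length1.
by rewrite /F; lia.
Qed.

(** Box sizes add under products, so [C] can be the sum of the box sizes of all generators and their
    inverses. *)
Lemma word_length_box : exists C, forall n u,
  (word_length T u <= n)%N -> box (C * n) u.
Proof.
have [m mP] := choice box_ex.
exists (\sum_(t <- T) (m t + m t^-1))%N => n u un; set C := (\sum_(t <- T) _)%N.
have CT (t : wreath N G) : (t \in gset T) || (t^-1 \in gset T) -> box C t.
  move=> tT; apply: box_le (mP t); rewrite /C; case/orP: tT => tT.
    by rewrite (big_rem t)//=; lia.
  by rewrite (big_rem t^-1)//= invgK; lia.
have [s [sn sT <-]] := word_lengthP T u.
have sC : (C * size s <= C * n)%N by rewrite leq_mul2l sn un orbT.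
apply: box_le sC _; move: sT; elim: {un sn} s => [_|t s IH /= /andP[/CT tC /IH]].
  by rewrite big_nil; apply: box1.
by rewrite big_cons mulnS; apply: boxM.
Qed.

(** A box is finite: its elements are encoded by a cursor in one finite ball and a map between two
    finite balls. The bound is only qualitative, enough for uniform boundedness. *)
Lemma box_word_length m : exists M, forall u, box m u -> (word_length T u <= M)%N.
Proof.
have [B BP] := ball_finite SN m; have [A AP] := ball_finite SG m.
pose b := [fset y in B]%fset; pose a := [fset x in A]%fset.
pose f (h : {ffun b -> a}) : C0 N G :=
  [fsfun y in b => if insub y is Some z then val (h z) else 1 | 1]%fset.
pose g (p : {ffun b -> a} * b) : wreath N G := Wreath (f p.1) (val p.2).
exists (\max_p word_length T (g p)) => u [um us ul].
have cb : cursor u \in b by rewrite inE; apply: BP.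
have la y : lamps u y \in a by rewrite inE; apply: AP.
suff -> : u = g ([ffun z => [` la (val z)]%fset], [` cb]%fset).
  exact: leq_bigmax.
rewrite /g /=; case: u um us ul cb la => [l c] /= um us ul cb la.
congr Wreath; apply/fsfunP => y; rewrite /f fsfunE.
case: ifPn => [yb|]; first by rewrite insubT /= ffunE.
rewrite inE => yB; apply: contrapT => /us /BP; exact/negP.
Qed.

End WreathMetric.

(** * The cover of the wreath product by pieces *)

Section WreathCover.
Variables (N G : groupType) (SN : genset N) (SG : genset G).
Variables (rho D K : nat) (E : nat -> G -> G -> Prop).
Hypothesis EK : colouring SG K (2 * rho) D E.
Local Open Scope group_scope.
Local Open Scope classical_set_scope.
Implicit Types (u v w : wreath N G) (x y : N) (i : nat).

(* The coordinates over the ball of radius rho around the cursor of [u] lie in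
   the rho-neighbourhood of a product of members of the i-th colour class. *)
Definition piece i u : set (wreath N G) := [set w |
  [/\ (gdist SN (cursor u) (cursor w) <= rho)%N,
      forall y, ~~ (gdist SN (cursor u) y <= rho)%N -> lamps w y = lamps u y &
      forall y, (gdist SN (cursor u) y <= rho)%N ->
        exists2 g, E i g (lamps u y) & (gdist SG g (lamps w y) <= rho)%N]].

Definition piece_cover : set (set (wreath N G)) := [set A | exists i u,
  [/\ (i < K)%N,
      forall y, (gdist SN (cursor u) y <= rho)%N -> E i (lamps u y) (lamps u y) &
      A = piece i u]].

Lemma piece_near i u v :
    (forall y, (gdist SN (cursor u) y <= rho)%N -> E i (lamps u y) (lamps u y)) ->
  box SN SG rho (u^-1 * v) -> piece i u v.
Proof.
move=> Eu [c s l].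
have E1 y : (gdist SN (cursor u) y <= rho)%N ->
    (gdist SG (lamps u y) (lamps v y) <= rho)%N.
  by move=> _; have := l ((cursor u)^-1 * y); rewrite lamps_div mulVKg.
split=> [//|y uy|y uy].
  apply: contrapT => vu; move/negP: uy; apply.
  apply: s; rewrite lamps_div mulVKg => /mulg1_eq; rewrite invgK.
  exact/nesym.
by exists (lamps u y); [apply: Eu|apply: E1].
Qed.

Lemma piece_box i u v w : (i < K)%N -> piece i u v -> piece i u w ->
  box SN SG (2 * rho + D) (v^-1 * w).
Proof.
move=> iK [vc vo vi] [wc wo wi]; have [Es Et Eb _] := EK iK.
have far y : (gdist SN (cursor v) y <= 2 * rho + D)%N \/ lamps v y = lamps w y.
  have [uy|uy] := boolP (gdist SN (cursor u) y <= rho)%N.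
    left; have := gdist_triangle SN (cursor u) (cursor v) y.
    rewrite (gdistC _ (cursor v) (cursor u)); lia.
  by right; rewrite vo ?wo.
split=> [|y|y].
- have := gdist_triangle SN (cursor u) (cursor v) (cursor w).
  rewrite (gdistC _ (cursor v) (cursor u)) /= -/(gdist SN _ _); lia.
- rewrite lamps_div => vw.
  case: (far (cursor v * y)) => [|E1]; first by rewrite /gdist mulKg.
  by case: vw; rewrite E1 mulVg.
- rewrite lamps_div; set z := _ * y.
  have [uz|uz] := boolP (gdist SN (cursor u) z <= rho)%N; last first.
    by rewrite vo ?wo// mulVg word_length1.
  have [g Eg vg] := vi z uz; have [h Eh wh] := wi z uz.
  have gh := Eb _ _ (Et _ _ _ Eg (Es _ _ Eh)).
  have := gdist_triangle SG g (lamps v z) (lamps w z).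
  have := gdist_triangle SG h g (lamps w z).
  rewrite (gdistC _ (lamps v z) g) -/(gdist SG _ _); lia.
Qed.

(** At each coordinate near the cursor the classes of [u] and [v] both come within [rho] of the lamp
    of [w], so the [2 * rho] separation makes them equal; elsewhere both lamps agree with [w]. *)
Lemma piece_eq i u v w : (i < K)%N -> cursor u = cursor v ->
  piece i u w -> piece i v w -> piece i u = piece i v.
Proof.
move=> iK.
suff sub u' v' : cursor u' = cursor v' -> piece i u' w -> piece i v' w ->
    piece i u' `<=` piece i v'.
  by move=> uv uw vw; apply/seteqP; split; apply: sub.
have [Es Et _ Ed] := EK iK.
have El g h : E i g h -> E i g g by move=> gh; apply: (Et h) => //; apply: Es.
move=> uv [_ uo ui] [_ vo vi] w' [wc wo wi]; split; rewrite -uv//.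
  by move=> y uy; rewrite wo// -uo// vo// -uv.
move=> y uy; have [g Eg gw] := wi y uy; exists g => //.
have [h Eh hw] := ui y uy; rewrite uv in uy; have [k Ek kw] := vi y uy.
apply: (Et _ _ _ Eg); apply: (Et h); first exact: Es.
apply: (Et k) => //; apply: Ed; [exact: El Eh|exact: El Ek|].
have := gdist_triangle SG (lamps w y) h k; rewrite (gdistC _ (lamps w y) k); lia.
Qed.

(** Among pieces through a common [w], one is determined by its colour and by the position of
    [cursor w] relative to its centre, an element of [B]. *)
Lemma piece_multiplicity (B : seq N) (V : set (set (wreath N G))) :
    (forall x, (word_length SN x <= rho)%N -> x \in B) ->
    V `<=` piece_cover -> \bigcap_(A in V) A !=set0 ->
  exists2 L : seq (set (wreath N G)), (size L <= K * size B)%N & V `<=` [set` L].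
Proof.
move=> BP VU [w Vw].
pose P i b A := V A /\ exists u, A = piece i u /\ b = (cursor u)^-1 * cursor w.
pose f i b : set (wreath N G) := xget set0 [set A | P i b A].
exists [seq f i b | i <- iota 0 K, b <- B].
  by rewrite size_allpairs size_iota.
move=> A VA /=; have [i [u [iK _ Au]]] := VU A VA.
have uw : piece i u w by rewrite -Au; apply: Vw.
apply/allpairsP; exists (i, (cursor u)^-1 * cursor w); split.
- by rewrite mem_iota.
- by apply: BP; case: uw.
have : P i ((cursor u)^-1 * cursor w) (f i ((cursor u)^-1 * cursor w)).
  by apply: (@xgetPex _ set0 [set A | P _ _ A]); exists A; split=> //; exists u.
move=> /= [Vf [v [fv /mulIg/invg_inj uv]]].
rewrite Au fv; apply: (@piece_eq i _ _ w) => //.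
by rewrite -fv; apply: Vw.
Qed.

End WreathCover.

Lemma counting_le (R : realType) (T : choiceType) (V : set T) (L : seq T) :
  (V `<=` [set` L])%classic -> (counting V <= (size L)%:R%:E :> \bar R)%E.
Proof.
move=> VL; have finV : finite_set V by apply: sub_finite_set VL _.
rewrite /counting asboolT// lee_fin ler_nat.
apply: uniq_leq_size => [|x]; first exact: fset_uniq.
by rewrite in_fset_set// inE => /VL.
Qed.

(** * Bounding the dimension function by the size of a ball *)

Section WreathDimension.
Variables (R : realType) (N G : groupType) (SN : genset N) (SG : genset G).
Variable T : genset (wreath N G).
Local Open Scope classical_set_scope.
Local Open Scope ring_scope.

Lemma ad_le n C (lam : R) (B : seq N) :
    (forall r, exists D E, colouring SG (n * size B).+1 r D E /\
      forall x, (missed (n * size B).+1 E x <= n)%N) ->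
    (forall m u, (word_length T u <= m)%N -> box SN SG (C * m) u) ->
    (forall x, (x \in B) = (word_length SN x <= C * Num.truncn lam)%N) ->
    0 < lam ->
  (ad (word_space R T) lam <= ((n * size B).+1 * size B)%N%:R%:E)%E.
Proof.
set l := Num.truncn lam; set rho := (C * l)%N; set K := (n * size B).+1.
move=> HG HC BP lam0; have [D [E [EK En]]] := HG (2 * rho)%N.
pose U : set (set (word_space R T)) := piece_cover SN SG rho K E.
have near_piece (u : wreath N G) : exists i, [/\ (i < K)%N, U (piece SN SG rho E i u)
    & forall v : wreath N G, (gdist T u v <= l)%N -> piece SN SG rho E i u v].
  (* The lamps of [u] are coloured simultaneously over the translate of [B], the ball around its
     cursor. *)
  have sB : (n * size [seq (cursor u * b)%g | b <- B] < K)%N by rewrite size_map.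
  have [i Ei] := common_colour (lamps u) En sB.
  have Eu y : (gdist SN (cursor u) y <= rho)%N -> E i (lamps u y) (lamps u y).
    by rewrite /gdist -BP => yB; apply: Ei; rewrite -(mulVKg (cursor u) y) map_f.
  exists i; split=> //; first by exists i, u.
  by move=> v uv; apply: piece_near => //; apply: HC.
have Ucov : \bigcup_(A in U) A = setT.
  apply/seteqP; split=> // u _; have [i [_ Ui Pi]] := near_piece u.
  by exists (piece SN SG rho E i u) => //; apply: Pi; rewrite gdistxx.
have Ubnd : uniformly_bounded U.
  have [M MP] := box_word_length SN SG T (2 * rho + D).
  apply/(@uniformly_boundedP R _ T); exists M => A x y [i [u [iK _ ->]]] ux uy.
  exact: MP _ (piece_box EK iK ux uy).
have ULeb : (lam%:E <= sup_lebesgue U)%E.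
  apply: ereal_sup_ubound; exists lam => //; split=> // A Alam.
  (* The empty set has diameter 0 and also needs a member containing it; any centre serves. *)
  have [u uA] : exists u : wreath N G, A !=set0 -> A u.
    by have [[u Au]|A0] := pselect (A !=set0); [exists u|exists 1%g].
  have [i [_ Ui Pi]] := near_piece u.
  exists (piece SN SG rho E i u) => // v Av; apply: Pi.
  (* Distances are integers, so a bound by [lam] is a bound by its integer part [l]. *)
  rewrite truncn_ge_nat; last exact: ltW.
  have H := (diam_leP A (ltW lam0)).1 Alam.
  by apply: H => //; apply: uA; exists v.
have Umul : (multiplicity U <= (K * size B)%N%:R%:E)%E.
  apply: ge_ereal_sup => _ [V [VU V0] <-].
  have BP' x : (word_length SN x <= rho)%N -> x \in B by rewrite BP.
  have [L LB VL] := piece_multiplicity EK BP' VU V0.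
  by apply: le_trans (counting_le _ VL) _; rewrite lee_fin ler_nat.
rewrite /ad; apply: (@le_trans _ _ (multiplicity U - 1)%E).
  by apply: leeB => //; apply: ereal_inf_lbound; exists U.
apply: le_trans Umul; rewrite leeBlDr// leeDl//.
Qed.

End WreathDimension.

(** * The polynomial bound *)

Local Open Scope ereal_scope.

Theorem theorem4p6 (R : realType) (N G : groupType) (SG : genset G) :
  finitely_generated N -> nilpotent_group N ->
  asdim (word_space R SG) < +oo ->
  forall T : genset (wreath N G),
    polynomial_dimension_growth (word_space R T).
Proof.
move=> [S0 S0gen] nilN /asdim_colouring[n HG] T.
pose SN := GenSet S0gen.
have [c [d HN]] := nilpotent_ball_growth SN nilN.
have [C HC] := word_length_box SN SG T.
(* [q] bounds [size B], so the next polynomial bounds (n |B| + 1) |B|. *)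
pose q : {poly R} := (c%:R *: (C%:R *: 'X + 1) ^+ d)%R.
exists ((n%:R *: q + 1) * q)%R => lam lam0.
set l := Num.truncn lam.
have [B [sB BP]] := HN (C * l)%N.
have lel : (l%:R <= lam)%R by rewrite truncn_le ltW.
have Bq : ((size B)%:R <= q.[lam])%R.
  rewrite !hornerE.
  apply: (@le_trans _ _ ((c * (C * l).+1 ^ d)%N%:R)%R); first by rewrite ler_nat.
  rewrite natrM natrX ler_wpM2l// lerXn2r ?nnegrE//.
    by rewrite addr_ge0// mulr_ge0// ltW.
  by rewrite -natr1 natrM lerD2r ler_wpM2l.
apply: le_trans (ad_le (n := n) (C := C) (B := B) _ HC BP lam0) _.
  (* There are more than [n] colours because [B] contains 1. *)
  apply: colouring_all HG _; rewrite ltnS leq_pmulr//.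
  by case: (B) (BP 1%g) => //; rewrite word_length1.
clearbody q; rewrite lee_fin !hornerE natrM -natr1 natrM.
by apply: ler_pM => //; rewrite lerD2r ler_wpM2l.
Qed.
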